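(* Let $F$ be a field, let $A(x)$ be a rational power series over $F$ with denominator $\prod_{i=1}^m(1-\alpha_ix)$ and let $B(x)$ be a rational power series over $F$ with denominator $\prod_{j=1}^n(1-\beta_jx)$, where the $\alpha_i$ and $\beta_j$ lie in some extension field of $F$. Then $A(x)*B(x)$ is a rational power series that may be written with denominator $\prod_{i=1}^m\prod_{j=1}^n(1-\alpha_i\beta_jx)$. Moreover, if $A(x)$ and $B(x)$ are proper then so is $A(x)*B(x)$.
   Context: The Hadamard product of $A(x)=\sum_{n\ge0}a_nx^n$ and $B(x)=\sum_{n\ge0}b_nx^n$ is $A(x)*B(x)=\sum_{n\ge0}a_nb_nx^n$. A rational power series is a formal power series equal to a quotient of two polynomials. It ''has (may be written with) denominator $D(x)$'' if it equals $N(x)/D(x)$ for some polynomial $N(x)$ (not necessarily in lowest terms; polynomial coefficients may lie in the extension field). A rational function is proper if the degree of its numerator is less than the degree of its denominator. *)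

(* Defs.v *)
From HB Require Import structures.
From mathcomp Require Import all_boot all_order all_algebra.

Set Implicit Arguments.
Unset Strict Implicit.
Unset Printing Implicit Defensive.

Import GRing.Theory.
Local Open Scope ring_scope.

(* The series with coefficients a_0, a_1, ... is the function n |-> a_n;      *)
(* series are compared extensionally, with =1.                                *)
Definition fps (R : nzRingType) : Type := nat -> R.

Definition fps_of_poly (R : nzRingType) (p : {poly R}) : fps R := fun k => p`_k.

Definition fps_mul (R : nzRingType) (A B : fps R) : fps R :=
  fun k => \sum_(i < k.+1) A i * B (k - i)%N.

Definition fps_map (R S : nzRingType) (f : R -> S) (A : fps R) : fps S :=
  fun k => f (A k).

Definition hadamard (R : nzRingType) (A B : fps R) : fps R :=
  fun k => A k * B k.

(* A = N / D, written without division: K[[x]] is an integral domain, so for  *)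
(* D != 0 the equation D * A = N says that A is the quotient N / D in the     *)
(* fraction field of K[[x]]. N / D need not be in lowest terms.               *)
Definition fps_is_quotient (K : fieldType) (A : fps K) (N D : {poly K}) : Prop :=
  D != 0 /\ fps_mul (fps_of_poly D) A =1 fps_of_poly N.

Definition rational_fps (K : fieldType) (A : fps K) : Prop :=
  exists N D : {poly K}, fps_is_quotient A N D.

Definition has_denominator (K : fieldType) (A : fps K) (D : {poly K}) : Prop :=
  exists N : {poly K}, fps_is_quotient A N D.

(* size is degree + 1, and size 0 = 0, so the zero series is proper. The      *)
(* choice of N and D is immaterial: N / D = N' / D' gives N * D' = N' * D,    *)
(* hence deg N - deg D = deg N' - deg D' when A != 0.                         *)
Definition proper_fps (K : fieldType) (A : fps K) : Prop :=
  exists N D : {poly K}, fps_is_quotient A N D /\ (size N < size D)%N.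

(* Main.v *)
Require Import Defs.
From HB Require Import structures.
From mathcomp Require Import all_boot all_order all_algebra.

Set Implicit Arguments.
Unset Strict Implicit.
Unset Printing Implicit Defensive.

Import GRing.Theory.
Local Open Scope ring_scope.

(** A polynomial [p] acts on sequences by [p(E)], where [E] is the shift
    [(E a)(n) = a(n+1)].  If [D] has degree at most [d], then the coefficient of
    [x^(n+d)] in [D(x) A(x)] is the term of index [n] of [p(E) a], where
    [p = x^d D(1/x)].  Hence the quotients of polynomials are the sequences
    killed by some [p(E)] with [p != 0], the proper ones are those killed by
    some [p(E)] with [p(0) != 0], and denominator [\prod_i (1 - c_i x)] means
    that some [E^M \prod_i (E - c_i)] kills the sequence ([split_denominatorP]).
    The theorem thus becomes three facts about killing a product [a b].

    Split denominators ([kills_prod_split]).  From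
      [(E - c d)(a b) = ((E - c) a) (E b) + c a ((E - d) b)]
    each application of a factor [E - c d] removes [E - c] from the annihilator
    of [a] in one summand and [E - d] from that of [b] in the other, so an
    induction applies.

    Rationality over [F] ([exists_hadamard_annihilator]).  If [p(E) a = 0] and
    [q(E) b = 0], reducing [x^k] modulo [p] and modulo [q] writes [E^k (a b)] as
    a combination of the products [(E^i a) (E^j b)] with [i < deg p] and
    [j < deg q], so [deg p * deg q + 1] of the shifts of [a b] are dependent.
    The coefficients of the dependency depend on [p] and [q] only.

    Properness ([exists_hadamard_annihilator_n0]).  This uniformity is what
    permits to divide the annihilator [r] of [a b] by its highest power [x^v]:
    if [p(0)] and [q(0)] are nonzero, then [a] and [b] can be extended
    backwards by [v] terms without losing their annihilators, [r] kills the
    product of the extensions, and so [r / x^v] kills [a b]. *)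

(** * Polynomials in the shift operator *)

Definition shift_op (K : fieldType) (p : {poly K}) (a : fps K) : fps K :=
  fun n => \sum_(i < size p) p`_i * a (n + i)%N.

Definition kills (K : fieldType) (p : {poly K}) (a : fps K) : Prop :=
  shift_op p a =1 (fun _ => 0).

Section ShiftOperators.

Variable K : fieldType.
Implicit Types (p q r D : {poly K}) (a b : fps K) (s t : seq K).

Lemma shift_op_widen N p a n : (size p <= N)%N ->
  shift_op p a n = \sum_(i < N) p`_i * a (n + i)%N.
Proof.
move=> le_p_N; rewrite /shift_op (big_ord_widen N (fun i => p`_i * a (n + i)%N)) //.
rewrite big_mkcond; apply: eq_bigr => i _.
by case: ltnP => // le_p_i; rewrite nth_default ?mul0r.
Qed.

Lemma eq_shift_op p a b : a =1 b -> shift_op p a =1 shift_op p b.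
Proof. by move=> eq_ab n; apply: eq_bigr => i _; rewrite eq_ab. Qed.

Lemma shift_opD p q a n :
  shift_op (p + q) a n = shift_op p a n + shift_op q a n.
Proof.
pose N := maxn (size p) (size q).
rewrite !(@shift_op_widen N) ?leq_maxl ?leq_maxr ?size_polyD //.
by rewrite -big_split; apply: eq_bigr => i _; rewrite coefD mulrDl.
Qed.

Lemma shift_opZ c p a n : shift_op (c *: p) a n = c * shift_op p a n.
Proof.
rewrite (@shift_op_widen (size p)) ?size_scale_leq // /shift_op mulr_sumr.
by apply: eq_bigr => i _; rewrite coefZ mulrA.
Qed.

Lemma shift_opC c a n : shift_op c%:P a n = c * a n.
Proof.
by rewrite (@shift_op_widen 1) ?size_polyC_leq1 // big_ord1 coefC addn0.
Qed.

Lemma shift_opMX p a n : shift_op (p * 'X) a n = shift_op p a n.+1.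
Proof.
rewrite (@shift_op_widen (size p).+1); last first.
  by apply: leq_trans (size_polyMleq _ _) _; rewrite size_polyX addn2.
rewrite big_ord_recl coefMX mul0r add0r; apply: eq_bigr => i _.
by rewrite coefMX /= addSnnS.
Qed.

Lemma shift_opM p q a : shift_op (p * q) a =1 shift_op p (shift_op q a).
Proof.
elim/poly_ind: p => [|p c IHp] n; first by rewrite mul0r -polyC0 !shift_opC !mul0r.
rewrite mulrDl mulrAC mul_polyC !shift_opD !shift_opMX IHp.
by rewrite shift_opZ shift_opC.
Qed.

Lemma shift_opXn k a n : shift_op 'X^k a n = a (n + k)%N.
Proof.
elim: k n => [|k IHk] n; first by rewrite expr0 shift_opC mul1r addn0.
by rewrite exprSr shift_opMX IHk addSnnS.
Qed.

Lemma shift_opXsubC c a n : shift_op ('X - c%:P) a n = a n.+1 - c * a n.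
Proof. by rewrite -polyCN shift_opD -['X]mul1r shift_opMX !shift_opC mulNr mul1r. Qed.

Lemma shift_op_add p a b n :
  shift_op p (fun k => a k + b k) n = shift_op p a n + shift_op p b n.
Proof. by rewrite -big_split; apply: eq_bigr => i _; rewrite mulrDr. Qed.

Lemma shift_op_scale p c a n :
  shift_op p (fun k => c * a k) n = c * shift_op p a n.
Proof. by rewrite mulr_sumr; apply: eq_bigr => i _; rewrite mulrCA. Qed.

Lemma shift_op0 p n : shift_op p (fun=> 0 : K) n = 0.
Proof. by apply: big1 => i _; rewrite mulr0. Qed.

Lemma eq_kills p a b : a =1 b -> kills p a -> kills p b.
Proof. by move=> eq_ab pa n; rewrite -(eq_shift_op p eq_ab). Qed.

Lemma killsM p q a : kills (p * q) a <-> kills p (shift_op q a).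
Proof. by split=> pqa n; have := pqa n; rewrite shift_opM. Qed.

Lemma kills_mull p q a : kills q a -> kills (p * q) a.
Proof.
by move=> qa; apply/killsM => n; rewrite (eq_shift_op p qa) shift_op0.
Qed.

Lemma kills_dvdp p q a : p %| q -> kills p a -> kills q a.
Proof. by move/divpK=> <-; apply: kills_mull. Qed.

Lemma kills_shift_op p q a : kills p a -> kills p (shift_op q a).
Proof. by move=> pa; apply/killsM; rewrite mulrC; apply: kills_mull. Qed.

(** * Annihilators of termwise products: split case *)

(** [size s + size t] decreases for both summands of
    [(E - c d)(a b) = ((E - c) a) (E b) + c a ((E - d) b)]; the operator left to
    apply is a multiple of the annihilator that the induction gives to each. *)
Lemma kills_prod_split s t a b :
  kills (\prod_(c <- s) ('X - c%:P)) a -> kills (\prod_(d <- t) ('X - d%:P)) b ->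
  kills (\prod_(c <- s) \prod_(d <- t) ('X - (c * d)%:P)) (fun k => a k * b k).
Proof.
have [k] := ubnP (size s + size t)%N.
elim: k => // k IHk in s t a b *.
case: s => [|c s] le_st pa pb.
  by move=> n; have:= pa n; rewrite !big_nil !shift_opC !mul1r => ->; rewrite mul0r.
case: t => [|d t] in le_st pb *.
  apply: (@kills_dvdp 1); first exact: dvd1p.
  by move=> n; have:= pb n; rewrite !big_nil !shift_opC !mul1r => ->; rewrite mulr0.
set Pst := \prod_(_ <- _) _.
(* [R] collects the factors of [Pst] other than [E - c d]. *)
pose R := \prod_(d' <- t) ('X - (c * d')%:P) *
  \prod_(c' <- s) \prod_(d' <- d :: t) ('X - (c' * d')%:P).
have ->: Pst = R * ('X - (c * d)%:P) by rewrite /Pst /R !big_cons -mulrA mulrC.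
apply/killsM.
pose a1 := shift_op ('X - c%:P) a; pose b1 := shift_op ('X - d%:P) b.
have leibniz : (fun n => a1 n * b n.+1 + c * (a n * b1 n))
    =1 shift_op ('X - (c * d)%:P) (fun k => a k * b k).
  move=> n; rewrite /a1 /b1 !shift_opXsubC mulrBl mulrBr mulrBr !mulrA.
  by rewrite addrA subrK [c * a n * d]mulrAC.
apply: (eq_kills leibniz) => n.
have a1P : kills (\prod_(c' <- s) ('X - c'%:P)) a1.
  by apply/killsM; move: pa; rewrite big_cons mulrC.
have b1P : kills (\prod_(d' <- t) ('X - d'%:P)) b1.
  by apply/killsM; move: pb; rewrite big_cons mulrC.
have EbP : kills (\prod_(d' <- d :: t) ('X - d'%:P)) (fun k => b k.+1).
  apply: (@eq_kills _ (shift_op 'X^1 b)) => [j|]; first by rewrite shift_opXn addn1.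
  exact: kills_shift_op.
have kill1 : kills R (fun k => a1 k * b k.+1).
  by apply: kills_mull; apply: IHk a1P EbP.
have kill2 : kills R (fun k => a k * b1 k).
  apply: kills_dvdp (IHk (c :: s) t a b1 _ pa b1P); last first.
    by move: le_st; rewrite /= addnS.
  rewrite big_cons dvdp_mul //.
  elim: (s) => [|c' s' IHs]; first by rewrite !big_nil.
  by rewrite !big_cons dvdp_mul // dvdp_mull.
by rewrite shift_op_add shift_op_scale kill1 kill2 mulr0 addr0.
Qed.

(** * Annihilators of termwise products: general case *)

Lemma shift_op_modp p q a n :
  kills p a -> shift_op q a n = shift_op (q %% p) a n.
Proof.
by move=> pa; rewrite {1}(divp_eq q p) shift_opD (kills_mull _ pa) add0r.
Qed.

Lemma nonzero_left_kernel (m : nat) (W : 'M[K]_(m.+1, m)) :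
  exists2 u : 'rV[K]_m.+1, u != 0 & u *m W = 0.
Proof.
have /rowV0Pn[u /sub_kermxP uW nz_u] : kermx W != 0; last by exists u.
rewrite kermx_eq0 /row_free neq_ltn; apply/orP; left.
by rewrite ltnS rank_leq_col.
Qed.

(** The annihilator is chosen before the sequences: the dependency is found
    among the elements [x^k (x) y^k] of [K[x]/(p) (x) K[y]/(q)], whose dimension
    is finite. *)
Lemma exists_hadamard_annihilator p q : p != 0 -> q != 0 ->
  exists2 r, r != 0 & forall a b, kills p a -> kills q b ->
    kills r (fun k => a k * b k).
Proof.
move=> nz_p nz_q; pose d := size p; pose e := size q.
pose W := \matrix_(k < (d * e).+1)
  mxvec (\matrix_(i < d, j < e) (('X^k %% p)`_i * ('X^k %% q)`_j)).
have [u nz_u uW] := nonzero_left_kernel W; exists (rVpoly u).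
  by apply: contraNneq nz_u => u0; rewrite -(rVpolyK u) u0 linear0.
move=> a b pa qb n; rewrite (@shift_op_widen (d * e).+1) ?size_poly //.
have sum_uW (i : 'I_d) (j : 'I_e) :
    \sum_(k < (d * e).+1) u 0 k * (('X^k %% p)`_i * ('X^k %% q)`_j) = 0.
  have := congr1 (fun M : 'rV_(d * e) => M 0 (mxvec_index i j)) uW.
  rewrite !mxE => uW0; rewrite -[RHS]uW0.
  by apply: eq_bigr => k _; rewrite mxE mxvecE mxE.
have reduce (k : nat) : a (n + k)%N * b (n + k)%N =
    \sum_(i < d) \sum_(j < e) (a (n + i)%N * b (n + j)%N) *
      (('X^k %% p)`_i * ('X^k %% q)`_j).
  rewrite -!shift_opXn (shift_op_modp _ _ pa) (shift_op_modp _ _ qb).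
  rewrite (@shift_op_widen d); last by rewrite ltnW ?ltn_modp.
  rewrite (@shift_op_widen e); last by rewrite ltnW ?ltn_modp.
  rewrite mulr_suml; apply: eq_bigr => i _; rewrite mulr_sumr.
  by apply: eq_bigr => j _; rewrite mulrC mulrACA mulrC [b _ * _]mulrC
    [_`_j * _]mulrC.
under eq_bigr => k _ do rewrite reduce coef_rVpoly_ord mulr_sumr.
rewrite exchange_big big1 // => i _ /=.
under eq_bigr => k _ do rewrite mulr_sumr.
rewrite exchange_big big1 // => j _ /=.
under eq_bigr => k _ do rewrite mulrCA.
by rewrite -mulr_sumr sum_uW mulr0.
Qed.

(** Since [p] is coprime to [x^v], Bezout gives an inverse of [E^v] on the
    sequences that [p] kills. *)
Lemma extend_backwards v p a : p`_0 != 0 -> kills p a ->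
  exists2 a', kills p a' & shift_op 'X^v a' =1 a.
Proof.
move=> nz_p0 pa.
have /Bezout_eq1_coprimepP[[x y] /= Bez] : coprimep p 'X^v.
  by rewrite coprimep_expr // coprimepX /root horner_coef0.
exists (shift_op y a) => [|n]; first exact: kills_shift_op.
rewrite -shift_opM mulrC -[RHS]mul1r -shift_opC -[1%:P]Bez shift_opD.
by rewrite (kills_mull _ pa) add0r.
Qed.

Lemma exists_hadamard_annihilator_n0 p q : p`_0 != 0 -> q`_0 != 0 ->
  exists2 r : {poly K}, r`_0 != 0 & forall a b, kills p a -> kills q b ->
    kills r (fun k => a k * b k).
Proof.
move=> nz_p0 nz_q0.
have nz0 (f : {poly K}) : f`_0 != 0 -> f != 0.
  by apply: contraNneq => ->; rewrite coef0.
have [r nz_r rP] := exists_hadamard_annihilator (nz0 _ nz_p0) (nz0 _ nz_q0).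
have [v [r' ]] := multiplicity_XsubC r 0.
rewrite nz_r /= subr0 /root horner_coef0 => nz_r'0 def_r.
exists r' => // a b pa qb.
have [a' pa' def_a] := extend_backwards v nz_p0 pa.
have [b' qb' def_b] := extend_backwards v nz_q0 qb.
have := rP _ _ pa' qb'; rewrite def_r => /killsM; apply: eq_kills => n.
by rewrite shift_opXn -def_a -def_b !shift_opXn.
Qed.

(** * Reversed denominators as annihilators *)

(** [x^d p(1/x)], for [p] of degree at most [d]. *)
Definition rev_poly (d : nat) p := \poly_(i < d.+1) p`_(d - i).

Lemma coef_rev_poly d p i : (rev_poly d p)`_i = if (i <= d)%N then p`_(d - i) else 0.
Proof. exact: coef_poly. Qed.

Lemma size_rev_poly d p : (size (rev_poly d p) <= d.+1)%N.
Proof. exact: size_poly. Qed.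

Lemma rev_polyK d p : (size p <= d.+1)%N -> rev_poly d (rev_poly d p) = p.
Proof.
move=> le_p_d; apply/polyP=> i; rewrite !coef_rev_poly leq_subr.
by case: leqP => [le_id | lt_di]; rewrite ?subKn // nth_default ?(leq_trans le_p_d).
Qed.

Lemma rev_poly_eq0 d p : (size p <= d.+1)%N -> (rev_poly d p == 0) = (p == 0).
Proof.
have rev0 : rev_poly d 0 = 0.
  by apply/polyP=> i; rewrite coef_rev_poly !coef0 if_same.
by move=> le_p_d; apply/eqP/eqP=> [r0 | ->//]; rewrite -(rev_polyK le_p_d) r0.
Qed.

Lemma rev_polyXn M d p : (size p <= d.+1)%N ->
  rev_poly (d + M) p = rev_poly d p * 'X^M.
Proof.
move=> le_p_d; apply/polyP=> i; rewrite coefMXn !coef_rev_poly.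
case: ltnP => [lt_iM | le_Mi]; last first.
  by rewrite leq_subLR [(M + d)%N]addnC subnBA.
rewrite ifT ?(leq_trans (ltnW lt_iM)) ?leq_addl // nth_default //.
by rewrite (leq_trans le_p_d) // -addnBA ?(ltnW lt_iM) // -addn1 leq_add2l subn_gt0.
Qed.

Lemma rev_poly_1subZX c d p : (size p <= d.+1)%N ->
  rev_poly d.+1 ((1 - c *: 'X) * p) = ('X - c%:P) * rev_poly d p.
Proof.
move=> le_p_d; apply/polyP=> i.
rewrite coef_rev_poly !mulrBl mul1r !coefB -scalerAl coefZ mul_polyC coefZ.
rewrite !coefXM !coef_rev_poly.
case: i => [|i] /=.
  by rewrite !subn0 /= (nth_default _ le_p_d).
rewrite ltnS subSS; case: (ltngtP i d) => [lt_id | lt_di | ->].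
- by rewrite subn_eq0 leqNgt lt_id /= subnS.
- by rewrite mulr0 subr0.
by rewrite subnn eqxx !mulr0.
Qed.

Lemma shift_op_rev d D a n : (size D <= d.+1)%N ->
  shift_op (rev_poly d D) a n = fps_mul (fps_of_poly D) a (n + d)%N.
Proof.
move=> le_D_d; rewrite (@shift_op_widen d.+1) ?size_rev_poly //.
pose G i := D`_i * a (n + d - i)%N.
have -> : fps_mul (fps_of_poly D) a (n + d)%N = \sum_(i < d.+1) G i.
  rewrite (big_ord_widen (n + d).+1 G) ?ltnS ?leq_addl // big_mkcond.
  apply: eq_bigr => i _; rewrite /G /fps_of_poly.
  by case: ltnP => // le_di; rewrite nth_default ?mul0r ?(leq_trans le_D_d).
rewrite (reindex_inj rev_ord_inj); apply: eq_bigr => i _ /=.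
rewrite coef_rev_poly /G subSS leq_subr subKn -1?ltnS //.
by rewrite addnBA -1?ltnS.
Qed.

(** The coefficients of [D a] from degree [d] on are exactly the terms of
    [rev_poly d D] applied to [a]; they vanish when the numerator has degree
    less than [d]. *)
Lemma quotient_kills d N D a : fps_is_quotient a N D ->
  (size D <= d.+1)%N -> (size N <= d)%N -> kills (rev_poly d D) a.
Proof.
move=> [_ eqN] le_D le_N n; rewrite shift_op_rev // eqN.
by rewrite /fps_of_poly nth_default // (leq_trans le_N) ?leq_addl.
Qed.

Lemma kills_quotient d D a : D != 0 -> (size D <= d.+1)%N ->
  kills (rev_poly d D) a ->
  exists2 N, fps_is_quotient a N D & (size N <= d)%N.
Proof.
move=> nz_D le_D Da.
exists (\poly_(k < d) fps_mul (fps_of_poly D) a k); last exact: size_poly.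
split=> // k; rewrite /fps_of_poly coef_poly; case: ltnP => // le_dk.
by have := Da (k - d)%N; rewrite shift_op_rev // subnK.
Qed.

Lemma rationalP a : rational_fps a <-> exists2 p, p != 0 & kills p a.
Proof.
split=> [[N [D quo]] | [p nz_p pa]].
  have [nz_D _] := quo; pose d := maxn (size N) (size D).
  have le_D : (size D <= d.+1)%N by rewrite ltnW // ltnS leq_maxr.
  exists (rev_poly d D); first by rewrite rev_poly_eq0.
  by apply: quotient_kills quo _ _; rewrite // leq_maxl.
have le_p : (size p <= (size p).+1)%N by [].
have [|||N quo _] := @kills_quotient (size p) (rev_poly (size p) p) a.
- by rewrite rev_poly_eq0.
- exact: size_rev_poly.
- by rewrite rev_polyK.
by exists N, (rev_poly (size p) p).
Qed.

(** A numerator over [x^d p(1/x)] has degree less than [d]; that denominator has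
    degree exactly [d] if and only if [p(0) != 0]. *)
Lemma properP a : proper_fps a <-> exists2 p : {poly K}, p`_0 != 0 & kills p a.
Proof.
split=> [[N [D [quo lt_ND]]] | [p nz_p0 pa]].
  have [nz_D _] := quo; have D_gt0 : (0 < size D)%N by rewrite size_poly_gt0.
  exists (rev_poly (size D).-1 D).
    by rewrite coef_rev_poly subn0 -lead_coefE lead_coef_eq0.
  apply: quotient_kills quo _ _; first by rewrite prednK.
  by rewrite -ltnS prednK.
have nz_p : p != 0 by apply: contraNneq nz_p0 => ->; rewrite coef0.
pose d := (size p).-1; have def_p : size p = d.+1 by rewrite prednK ?size_poly_gt0.
have le_p : (size p <= d.+1)%N by rewrite def_p.
have [|||N quo le_N] := @kills_quotient d (rev_poly d p) a.
- by rewrite rev_poly_eq0.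
- exact: size_rev_poly.
- by rewrite rev_polyK.
exists N, (rev_poly d p); split=> //; apply: leq_ltn_trans le_N _.
by rewrite ltnNge; apply: contra nz_p0 => /leq_sizeP/(_ d (leqnn d));
  rewrite coef_rev_poly leqnn subnn => ->.
Qed.

Lemma size_prod_1subZX s :
  (size (\prod_(c <- s) (1 - c *: 'X) : {poly K})%R <= (size s).+1)%N.
Proof.
elim: s => [|c s IHs]; first by rewrite big_nil size_poly1.
rewrite big_cons mulrBl mul1r -scalerAl -scaleNr (leq_trans (size_polyD _ _)) //.
rewrite geq_max (leq_trans IHs) //= (leq_trans (size_scale_leq _ _)) //.
by rewrite (leq_trans (size_polyMleq _ _)) // size_polyX.
Qed.

Lemma rev_prod_1subZX s :
  rev_poly (size s) (\prod_(c <- s) (1 - c *: 'X)) = \prod_(c <- s) ('X - c%:P).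
Proof.
elim: s => [|c s IHs].
  by rewrite !big_nil; apply/polyP=> -[|i]; rewrite coef_rev_poly !coefC.
by rewrite !big_cons rev_poly_1subZX ?size_prod_1subZX // IHs.
Qed.

Lemma prod_1subZX_neq0 s : \prod_(c <- s) (1 - c *: 'X) != 0 :> {poly K}.
Proof.
by rewrite -(rev_poly_eq0 (size_prod_1subZX s)) rev_prod_1subZX
  monic_neq0 ?monic_prod_XsubC.
Qed.

(** The shift by [M] accounts for the polynomial part of an improper series.  A
    bound [M0] that any larger [M] may replace lets two series share one [M]. *)
Lemma split_denominatorP s a :
  has_denominator a (\prod_(c <- s) (1 - c *: 'X)) <->
  exists M0, forall M, (M0 <= M)%N ->
    kills (\prod_(c <- s) ('X - c%:P)) (shift_op 'X^M a).
Proof.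
have le_s M : (size (\prod_(c <- s) (1 - c *: 'X) : {poly K})%R <= (size s + M).+1)%N.
  by rewrite (leq_trans (size_prod_1subZX s)) // ltnS leq_addr.
have revE M : rev_poly (size s + M) (\prod_(c <- s) (1 - c *: 'X)) =
    \prod_(c <- s) ('X - c%:P) * 'X^M.
  by rewrite rev_polyXn ?size_prod_1subZX // rev_prod_1subZX.
split=> [[N quo] | [M /(_ M (leqnn M)) sa]].
  exists (size N) => M le_NM; apply/killsM; rewrite -revE.
  by apply: quotient_kills quo _ _; rewrite // (leq_trans le_NM) ?leq_addl.
have [|||N quo _] := @kills_quotient (size s + M) (\prod_(c <- s) (1 - c *: 'X)) a.
- exact: prod_1subZX_neq0.
- exact: le_s.
- by rewrite revE; apply/killsM.
by exists N.
Qed.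

End ShiftOperators.

(** * Hadamard products of rational series *)

Lemma has_denominator_ext (K : fieldType) (a b : fps K) (D : {poly K}) :
  a =1 b -> has_denominator a D -> has_denominator b D.
Proof.
move=> eq_ab [N [nz_D eqN]]; exists N; split=> // k; rewrite -eqN.
by apply: eq_bigr => i _; rewrite eq_ab.
Qed.

Lemma hadamard_split_denominator (K : fieldType) (s t : seq K) (a b : fps K) :
  has_denominator a (\prod_(c <- s) (1 - c *: 'X)) ->
  has_denominator b (\prod_(d <- t) (1 - d *: 'X)) ->
  has_denominator (hadamard a b)
    (\prod_(c <- s) \prod_(d <- t) (1 - (c * d) *: 'X)).
Proof.
move=> /split_denominatorP[Ma sa] /split_denominatorP[Mb tb].
pose st := [seq c * d | c <- s, d <- t].
have <- : \prod_(c <- st) (1 - c *: 'X) =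
    \prod_(c <- s) \prod_(d <- t) (1 - (c * d) *: 'X) by rewrite big_allpairs_dep.
apply/split_denominatorP; exists (maxn Ma Mb) => M.
rewrite geq_max => /andP[/sa{}sa /tb{}tb].
rewrite big_allpairs_dep; apply: eq_kills (kills_prod_split sa tb) => n.
by rewrite !shift_opXn.
Qed.

Theorem theorem13 (F L : fieldType) (iota : {rmorphism F -> L})
    (m n : nat) (alpha : 'I_m -> L) (beta : 'I_n -> L) (A B : fps F)
    (ratA : rational_fps A)
    (denA : has_denominator (fps_map iota A) (\prod_(i < m) (1 - alpha i *: 'X)))
    (ratB : rational_fps B)
    (denB : has_denominator (fps_map iota B) (\prod_(j < n) (1 - beta j *: 'X))) :
  [/\ rational_fps (hadamard A B),
      has_denominator (fps_map iota (hadamard A B))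
        (\prod_(i < m) \prod_(j < n) (1 - (alpha i * beta j) *: 'X))
    & proper_fps A -> proper_fps B -> proper_fps (hadamard A B)].
Proof.
split.
- move: ratA ratB => /rationalP[p nz_p pA] /rationalP[q nz_q qB].
  have [r nz_r rP] := exists_hadamard_annihilator nz_p nz_q.
  by apply/rationalP; exists r => //; apply: rP.
- apply: (@has_denominator_ext _ (hadamard (fps_map iota A) (fps_map iota B))).
    by move=> k; rewrite /hadamard /fps_map rmorphM.
  pose s := [seq alpha i | i <- enum 'I_m]; pose t := [seq beta j | j <- enum 'I_n].
  have dA : has_denominator (fps_map iota A) (\prod_(c <- s) (1 - c *: 'X)).
    by rewrite big_map big_enum.
  have dB : has_denominator (fps_map iota B) (\prod_(d <- t) (1 - d *: 'X)).
    by rewrite big_map big_enum.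
  have := hadamard_split_denominator dA dB.
  rewrite big_map big_enum; congr has_denominator; apply: eq_bigr => i _.
  by rewrite big_map big_enum.
move=> /properP[p nz_p pA] /properP[q nz_q qB].
have [r nz_r rP] := exists_hadamard_annihilator_n0 nz_p nz_q.
by apply/properP; exists r => //; apply: rP.
Qed.
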